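(* Let $n>5$ and $3\le k\le n$. Consider all signed complete graphs $(K_n,U^-)$ where $U$ ranges over the unicyclic subgraphs of $K_n$ with exactly $k$ vertices. If $U$ is such that $(K_n,U^-)$ has maximum index among all of these, then $U$ is isomorphic to the graph consisting of a triangle together with $k-3$ further vertices all adjacent (only) to one and the same vertex of the triangle.
   Context: A unicyclic graph is a connected graph containing exactly one cycle. For a subgraph $H$ of $K_n$, $(K_n,H^-)$ denotes the signed complete graph on $n$ vertices whose negative edges are exactly the edges of $H$ and all other edges positive; its adjacency matrix has entry $-1$ for negative edges, $+1$ for positive edges and $0$ on the diagonal. The index of a signed graph is the largest eigenvalue of its adjacency matrix. *)

(* Defs.v *)
From mathcomp Require Import all_boot all_order all_algebra.
From mathcomp Require Import reals.
Set Implicit Arguments. Unset Strict Implicit. Unset Printing Implicit Defensive.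
Import Order.TTheory GRing.Theory Num.Theory.
Local Open Scope ring_scope.

Definition is_subgraph n (V : {set 'I_n}) (E : {set {set 'I_n}}) : Prop :=
  forall e, e \in E -> #|e| = 2%N /\ e \subset V.

Definition eadj n (E : {set {set 'I_n}}) : rel 'I_n :=
  fun x y => [set x; y] \in E.

Definition sconnected n (V : {set 'I_n}) (E : {set {set 'I_n}}) : Prop :=
  forall x y, x \in V -> y \in V -> connect (eadj E) x y.

Definition edeg n (C : {set {set 'I_n}}) (x : 'I_n) : nat :=
  #|[set e in C | x \in e]|.

Definition is_cycle n (C : {set {set 'I_n}}) : Prop :=
  [/\ C != set0,
      (forall x, edeg C x = 0%N \/ edeg C x = 2%N) &
      (forall x y, x \in \bigcup_(e in C) e -> y \in \bigcup_(e in C) e ->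
         connect (eadj C) x y)].

Definition unicyclic n (V : {set 'I_n}) (E : {set {set 'I_n}}) : Prop :=
  [/\ is_subgraph V E, sconnected V E &
      exists! C : {set {set 'I_n}}, C \subset E /\ is_cycle C].

(* Adjacency matrix of the signed complete graph (K_n, H^-) with H having
   edge set E: -1 on edges of H, +1 on other pairs, 0 on the diagonal. *)
Definition sadj (R : ringType) n (E : {set {set 'I_n}}) : 'M[R]_n :=
  \matrix_(i, j) (if i == j then 0 else if [set i; j] \in E then -1 else 1).

Definition is_index (R : realFieldType) n (A : 'M[R]_n) (lam : R) : Prop :=
  eigenvalue A lam /\ (forall mu, eigenvalue A mu -> mu <= lam).

(* The graph on 'I_k: triangle {0,1,2} plus vertices 3..k-1 all adjacent
   only to vertex 0. *)
Definition tri_pendant k (i j : 'I_k) : bool :=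
  (i != j) && [|| val i == 0%N, val j == 0%N | (val i < 3)%N && (val j < 3)%N].

Definition iso_tri_pendant n k (V : {set 'I_n}) (E : {set {set 'I_n}}) : Prop :=
  exists f : 'I_k -> 'I_n,
    [/\ injective f, f @: setT = V &
        forall i j, ([set f i; f j] \in E) = tri_pendant i j].

(* Main.v *)
Require Import Defs.
From mathcomp Require Import all_boot all_order all_algebra.
From mathcomp Require Import reals.
From mathcomp Require Import ring lra.
Import Order.TTheory GRing.Theory Num.Theory.
Local Open Scope ring_scope.

(** Let [x] be an eigenvector for the index [lam] of an extremal graph [E].  As
    [x A x^T = (sum x)^2 - |x|^2 - 4 S(E)] with [S(E)] the sum of [x i * x j] over
    the edges, [E] minimises [S] among unicyclic graphs on [k] vertices, and every
    other minimiser has [x] as a [lam]-eigenvector too.  A unicyclic graph is a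
    rooted spanning tree plus any chosen edge of its cycle, so [S] is bounded below
    by giving each vertex its cheapest parent.  If [V] carries at most one entry of
    one of the two signs, the minimum is attained by a triangle with pendant edges
    at one vertex [c]; comparing the eigenvector equations at [c] shows that [c] is
    joined in [E] to all of [V].  Otherwise the minimum is attained by a graph [D]
    containing a 4-cycle; making all entries of [x] but the smallest one nonnegative
    and passing to a triangle with pendant edges does not decrease the quadratic
    form, and a sixth vertex ([n > 5]) excludes equality, unless [k = 4], where [D]
    forces [lam = 3], while [lam > 3]. *)

Set Implicit Arguments.
Unset Strict Implicit.

(** * Unicyclic graphs as rooted trees plus an edge *)

Section Graphs.
Local Open Scope nat_scope.
Variable n : nat.
Implicit Types (V K : {set 'I_n}) (C E F : {set {set 'I_n}}) (c : 'I_n).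

Lemma eadj_sym E : symmetric (eadj E).
Proof. by move=> x y; rewrite /eadj setUC. Qed.

Lemma connect_eadj_sym E : connect_sym (eadj E).
Proof. exact/sym_connect_sym/eadj_sym. Qed.

Lemma sub_connect_eadj E F x y :
  E \subset F -> connect (eadj E) x y -> connect (eadj F) x y.
Proof.
move=> /subsetP sEF; apply: connect_sub => u v uv.
by apply: connect1; apply: sEF.
Qed.

Lemma next_neq_prev (p : seq 'I_n) x :
  uniq p -> 2 < size p -> x \in p -> next p x != prev p x.
Proof.
move=> Up sp xp; apply/eqP=> eq_np.
have: next p (next p x) = x by rewrite eq_np next_prev.
case: (rot_to xp) => i q def_q; rewrite -!(next_rot i Up).
have: uniq (rot i p) by rewrite rot_uniq.
have: 2 < size (rot i p) by rewrite size_rot.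
rewrite {}def_q; case: q => [|y [|z q]] //= _.
rewrite !inE !negb_or eqxx => /andP[/and3P[xy xz _] _].
by rewrite eqxx eq_sym (negPf xy) => /esym/eqP; rewrite (negPf xz).
Qed.

(** [next] wraps around, so the edge closing up the sequence is included. *)
Definition seq_edges (p : seq 'I_n) : {set {set 'I_n}} :=
  [set [set x; next p x] | x in p].

Lemma seq_edges_cycle (p : seq 'I_n) :
  uniq p -> 2 < size p -> is_cycle (seq_edges p).
Proof.
move=> Up sp.
have cov : \bigcup_(e in seq_edges p) e = [set x in p].
  apply/setP=> x; rewrite inE; apply/bigcupP/idP => [[e /imsetP[y yp ->]]|xp].
    by rewrite !inE => /orP[]/eqP-> //; rewrite mem_next.
  by exists [set x; next p x]; rewrite ?set21 //; apply: imset_f.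
split.
- apply/set0Pn; case: p sp {Up cov} => // x p _.
  by exists [set x; next (x :: p) x]; apply: imset_f; rewrite mem_head.
- move=> x; case xp: (x \in p); last first.
    left; apply: eq_card0 => e; rewrite !inE; apply/negP=> /andP[eE xe].
    suff: x \in \bigcup_(e in seq_edges p) e by rewrite cov inE xp.
    by apply/bigcupP; exists e.
  right; rewrite /edeg.
  have -> : [set e in seq_edges p | x \in e]
            = [set [set x; next p x]; [set x; prev p x]].
    apply/setP=> e; rewrite !inE; apply/andP/orP => [[/imsetP[y yp ->]]|].
      rewrite !inE => /orP[]/eqP ->; first by left.
      by right; rewrite prev_next // setUC.
    case=> /eqP->; rewrite set21; split=> //; first exact: imset_f.
    apply/imsetP; exists (prev p x); first by rewrite mem_prev.
    by rewrite next_prev // setUC.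
  rewrite cards2; case: eqP => // /setP/(_ (next p x)).
  rewrite set22 !inE => /esym/orP[]/eqP.
    move=> nx; have := next_neq_prev Up sp xp.
    by rewrite -{2}nx prev_next // nx eqxx.
  by move/eqP; rewrite (negPf (next_neq_prev Up sp xp)).
- rewrite cov => x y; rewrite !inE => xp yp.
  apply: (@connect_cycle _ _ p) => //.
  by apply: (sub_in_cycle _ (allss p) (cycle_next Up)) => u v up vp /eqP <-; apply: imset_f.
Qed.

(** A duplicate-free path from [a] to [b] in [F] closes up with the new edge; as that edge is not in
    [F], the path has an inner vertex and the cycle has length at least 3. *)
Lemma fundamental_cycle F a b :
  connect (eadj F) a b -> a != b -> [set a; b] \notin F ->
  exists C, [/\ C \subset [set a; b] |: F, [set a; b] \in C & is_cycle C].
Proof.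
case/connectP=> p0 pp0 -> {b}; case/shortenP: pp0 => p pp Up _.
move=> ab abF; exists (seq_edges (a :: p)).
have sp : 1 < size p.
  case: p pp ab abF {Up} => [|u [|v p]] //=; first by rewrite eqxx.
  by rewrite andbT /eadj => ->.
have cyc : cycle (eadj ([set a; last a p] |: F)) (a :: p).
  rewrite /= rcons_path; apply/andP; split; last by rewrite /eadj setUC setU11.
  by apply: sub_path pp => u v uv; rewrite /eadj setU1r.
split; last exact: seq_edges_cycle.
- by apply/subsetP=> e /imsetP[x xp ->]; exact: (next_cycle cyc xp).
- apply/imsetP; exists (last a p); first exact: mem_last.
  have := cycle_next Up; rewrite /cycle rcons_path => /andP[_ /eqP nx].
  by rewrite [next _ _]nx setUC.
Qed.

Definition tree_edges V c (par : 'I_n -> 'I_n) : {set {set 'I_n}} :=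
  [set [set v; par v] | v in V :\ c].

(** [rk] need not be the depth: any measure dropping from child to parent rules out cycles and makes
    every vertex climb to [c]. *)
Definition rooted V c (par : 'I_n -> 'I_n) (rk : 'I_n -> nat) : Prop :=
  c \in V /\ forall v, v \in V :\ c -> par v \in V /\ rk (par v) < rk v.

Section Rooted.
Variables (V : {set 'I_n}) (c : 'I_n) (par : 'I_n -> 'I_n) (rk : 'I_n -> nat).
Hypothesis rV : rooted V c par rk.
Let T := tree_edges V c par.

Lemma par_neq v : v \in V :\ c -> par v != v.
Proof. by case/(rV.2 _)=> _; apply: contraTneq => ->; rewrite ltnn. Qed.

Lemma tree_subgraph : is_subgraph V T.
Proof.
move=> e /imsetP[v vV ->]; rewrite cards2 eq_sym par_neq //; split=> //.
rewrite subUset !sub1set; have [-> _] := rV.2 _ vV.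
by move: vV; rewrite inE => /andP[_ ->].
Qed.

Lemma tree_connected : sconnected V T.
Proof.
have toc v : v \in V -> connect (eadj T) v c.
  elim: {v}(rk v) {-2}v (leqnn (rk v)) => [|r IHr] v rv vV;
    have [->|vc] := eqVneq v c; rewrite ?connect0 //;
    have vVc : v \in V :\ c by [rewrite !inE vc];
    have [pV lt] := rV.2 _ vVc.
    by have := leq_trans lt rv.
  apply: connect_trans (IHr _ _ pV); last by rewrite -ltnS; apply: leq_trans lt rv.
  by apply: connect1; apply: imset_f.
move=> x y xV yV; apply: connect_trans (toc _ xV) _.
by rewrite connect_eadj_sym toc.
Qed.

Lemma tree_edge_inj : {in V :\ c &, injective (fun v => [set v; par v])}.
Proof.
move=> u v uV vV eq_uv; apply/eqP/negPn/negP=> uv.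
have /setP/(_ u) := eq_uv; rewrite set21 !inE (negPf uv) => /esym/eqP up.
have /setP/(_ v) := eq_uv; rewrite set21 !inE eq_sym (negPf uv) => /eqP vp.
have [_] := rV.2 _ uV; have [_] := rV.2 _ vV.
by rewrite -up -vp => /ltn_trans h /h; rewrite ltnn.
Qed.

(* The deepest vertex covered by [C] only meets its parent edge. *)
Lemma tree_even_subset0 C :
  C \subset T -> (forall x, ~~ odd (edeg C x)) -> C = set0.
Proof.
move=> /subsetP sCT evC; apply/eqP/negPn/negP => /set0Pn[e eC].
have /imsetP[v0 v0V e0] := sCT _ eC.
pose P v := (v \in V :\ c) && ([set v; par v] \in C).
have Pv0 : P v0 by rewrite /P v0V -e0.
case: (arg_maxnP rk Pv0) => v /andP[vV vC] vmax.
have := evC v; suff -> : edeg C v = 1 by [].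
rewrite /edeg -(cards1 [set v; par v]); apply: eq_card => f; rewrite !inE.
apply/andP/eqP => [[fC]|->]; last by rewrite set21.
have /imsetP[u uV fE] := sCT _ fC; rewrite fE !inE => /orP[]/eqP vE.
  by rewrite vE.
have := vmax u; rewrite /P uV -fE fC => /(_ isT).
by have [_] := rV.2 _ uV; rewrite -vE ltnNge => /negP.
Qed.

(** Existence is the fundamental cycle of the chord. For uniqueness, every cycle must use the chord,
    so the symmetric difference of two cycles is an even-degree subset of the tree, hence empty. *)
Lemma unicyclic_tree a b :
  a \in V -> b \in V -> a != b -> [set a; b] \notin T ->
  unicyclic V ([set a; b] |: T).
Proof.
move=> aV bV ab abT; split.
- move=> e /setU1P[->|/tree_subgraph//].
  by rewrite cards2 ab subUset !sub1set aV bV.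
- move=> x y xV yV; apply: sub_connect_eadj (subsetUr _ _) _.
  exact: tree_connected.
have [C [sC abC cC]] := fundamental_cycle (tree_connected aV bV) ab abT.
have evD C' x : is_cycle C' -> odd (edeg C' x) = false.
  by case=> _ /(_ x)[]->.
have abI C' : C' \subset [set a; b] |: T -> is_cycle C' -> [set a; b] \in C'.
  move=> sC' cC'; apply/negPn/negP=> abC'.
  have C'0 : C' = set0.
    apply: tree_even_subset0 => [|x]; last by rewrite evD.
    apply/subsetP=> e eC'; have /setU1P[e_ab|//] := subsetP sC' _ eC'.
    by rewrite -e_ab eC' in abC'.
  by case: cC'; rewrite C'0 eqxx.
exists C; split=> // C' [sC' cC'].
have sD : (C :\: C') :|: (C' :\: C) = set0.
  apply: tree_even_subset0 => [|x].
    apply/subsetP=> e; rewrite !inE => /orP[]/andP[eN eI].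
      have /setU1P[e_ab|//] := subsetP sC _ eI.
      by rewrite e_ab abI in eN.
    have /setU1P[e_ab|//] := subsetP sC' _ eI.
    by rewrite e_ab abC in eN.
  pose st (A : {set {set 'I_n}}) := [set e in A | x \in e].
  have -> : edeg ((C :\: C') :|: (C' :\: C)) x
            = #|st C :\: st C'| + #|st C' :\: st C|.
    rewrite -cardsUI.
    have -> : (st C :\: st C') :&: (st C' :\: st C) = set0.
      by apply/setP=> e; rewrite !inE; do 3?case: (_ \in _).
    rewrite cards0 addn0; apply: eq_card => e.
    by rewrite !inE; do 3?case: (_ \in _).
  have := evD _ x cC; have := evD _ x cC'.
  rewrite -[edeg C' x](cardsID (st C)) -[edeg C x](cardsID (st C')).
  rewrite -/(st C) -/(st C') !oddD setIC.
  by do 3!case: (odd _).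
apply/eqP; rewrite eqEsubset -!setD_eq0 -!subset0 -{1}sD -{1}sD.
by rewrite subsetUl subsetUr.
Qed.

End Rooted.

(** The tree grows from [c] one vertex at a time, along an edge of [F] leaving the current vertex
    set [W]. *)
Lemma rooted_grow V F c :
  is_subgraph V F -> sconnected V F -> c \in V ->
  exists par rk, rooted V c par rk /\ tree_edges V c par \subset F.
Proof.
move=> sF cF cV.
suff grow j : 0 < j <= #|V| -> exists W : {set 'I_n}, [/\ W \subset V, #|W| = j &
    exists par rk, rooted W c par rk /\ tree_edges W c par \subset F].
  have [|W [sW eqW [par [rk Hr]]]] := grow #|V|.
    by rewrite leqnn andbT; apply/card_gt0P; exists c.
  exists par, rk; suff <- : W = V by [].
  by apply/eqP; rewrite eqEcard sW eqW leqnn.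
elim: j => [//|[|j] IHj] /andP[_ jV].
  exists [set c]; rewrite sub1set cards1; split=> //.
  exists id, (fun=> 0); rewrite /rooted /tree_edges setDv imset0 sub0set set11.
  by split=> //; split=> // v; rewrite inE.
have [W [sW eqW [par [rk [[cW rW] tW]]]]] := IHj (ltnW jV).
have [u [v [uW vW uv]]] : exists u v, [/\ u \in W, v \notin W & eadj F u v].
  have /subsetPn[y yV yW] : ~~ (V \subset W).
    by apply: contraL jV => /subset_leq_card; rewrite eqW -ltnNge ltnS.
  case: (boolP [exists u, exists v, [&& u \in W, v \notin W & eadj F u v]]).
    by move=> /existsP[u /existsP[v /and3P[? ? ?]]]; exists u, v.
  (* Without a leaving edge [W] is closed under adjacency, so connectedness puts [y] into it. *)
  move=> nex; have clW : closed (eadj F) (mem W).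
    apply: (intro_closed (connect_eadj_sym F)) => u v uv uW.
    apply: contraNT nex => vW.
    by apply/existsP; exists u; apply/existsP; exists v; apply/and3P.
  by have := closed_connect clW (cF c y cV yV); rewrite cW (negPf yW).
have vV : v \in V by have [_ /subsetP->//] := sF _ uv; rewrite set22.
exists (v |: W); split.
- by rewrite subUset sub1set vV.
- by rewrite cardsU1 vW eqW.
exists [eta par with v |-> u], [eta rk with v |-> (rk u).+1].
have nv w : w \in W -> (w == v) = false by move=> wW; apply: contraNF vW => /eqP<-.
split; first split.
- by rewrite setU1r.
- move=> w; rewrite !inE /=; have [->|wv] := eqVneq w v.
    by rewrite (nv u) // uW orbT.
  move=> /andP[wc wW]; have /rW[pW lt] : w \in W :\ c by rewrite !inE wc.
  by rewrite (nv (par w)) // pW orbT.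
apply/subsetP=> e /imsetP[w]; rewrite !inE => /andP[wc].
have [->|wv] := eqVneq w v => /=.
  by move=> _ ->; rewrite eqxx setUC.
move=> wW ->; rewrite (negPf wv); apply: (subsetP tW).
by apply/imsetP; exists w; rewrite // !inE wc.
Qed.

Lemma sum_edeg C K : \sum_(x in K) edeg C x = \sum_(e in C) #|e :&: K|.
Proof.
under eq_bigr => x _ do rewrite /edeg -sum1_card big_mkcond /=.
rewrite exchange_big [RHS]big_mkcond /=; apply: eq_bigr => e _.
rewrite -sum1_card big_mkcond [in RHS]big_mkcond [LHS]big_mkcond /=.
case eC: (e \in C).
  by apply: eq_bigr => x _; rewrite !inE eC; do 2!case: (_ \in _).
by apply: big1 => x _; rewrite inE eC /=; case: ifP.
Qed.

(* Handshake parity: on the component of [a], all degrees are even and {a, b}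
   is the only edge that could leave it. *)
Lemma cycle_minus_edge_connected C a b :
  (forall e, e \in C -> #|e| = 2) -> is_cycle C -> [set a; b] \in C ->
  connect (eadj (C :\ [set a; b])) a b.
Proof.
move=> C2 [_ degC _] abC; apply/negPn/negP=> nab.
pose K := [set x | connect (eadj (C :\ [set a; b])) a x].
have aK : a \in K by rewrite inE connect0.
have bK : b \notin K by rewrite inE.
have /negP[] : ~~ (2 %| \sum_(e in C) #|e :&: K|); last first.
  by rewrite -sum_edeg; apply: dvdn_sum => x _; case: (degC x) => ->.
rewrite (bigD1 [set a; b]) //= dvdn_addl.
  have -> : [set a; b] :&: K = [set a].
    apply/setP=> x; rewrite in_setI !in_set1 in_set2.
    have [->|xa] := eqVneq x a; first by rewrite aK.
    by have [->|xb] := eqVneq x b; rewrite ?(negPf bK).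
  by rewrite cards1.
apply: dvdn_sum => e /andP[eC eab].
have /eqP/cards2P[p [q [pq eE]]] := C2 _ eC.
have pqK : (p \in K) = (q \in K).
  have pq1 : eadj (C :\ [set a; b]) p q by rewrite /eadj -eE !inE eab.
  rewrite !inE; apply/idP/idP => h; apply: connect_trans h (connect1 _) => //.
  by rewrite eadj_sym.
have := C2 _ eC; rewrite {}eE => c2.
case qK: (q \in K).
  by rewrite (setIidPl _) ?c2 // subUset !sub1set pqK qK.
suff -> : [set p; q] :&: K = set0 by rewrite cards0.
by apply/setP=> x; rewrite !in_setI in_set2 in_set0; case: eqVneq => [->|_];
   [rewrite pqK qK | case: eqVneq => [->|_] //; rewrite qK].
Qed.

(** Deleting a cycle edge keeps the graph connected, so a spanning tree rooted at [c] remains; a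
    further edge outside that tree would close a cycle avoiding [e], against uniqueness. *)
Lemma cycle_edge_decomp V E C c e :
  unicyclic V E -> C \subset E -> is_cycle C -> e \in C -> c \in V ->
  exists par rk, [/\ rooted V c par rk, E = e |: tree_edges V c par
                  & e \notin tree_edges V c par].
Proof.
move=> [sE cE [C0 [_ uC0]]] sCE cC eC cV.
have CE f : f \in C -> f \in E by apply: (subsetP sCE).
have [/eqP/cards2P[a [b [ab eE]]] _] := sE _ (CE _ eC).
have cab : connect (eadj (E :\ e)) a b.
  apply: sub_connect_eadj (setSD _ sCE) _; rewrite eE.
  apply: cycle_minus_edge_connected => // [f fC|]; last by rewrite -eE.
  by have [] := sE _ (CE _ fC).
have sF : is_subgraph V (E :\ e) by move=> f /setD1P[_ /sE].
have cF : sconnected V (E :\ e).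
  move=> x y xV yV; apply: connect_sub (cE _ _ xV yV) => u v uv.
  have [uve|uve] := eqVneq [set u; v] e; last by apply: connect1; apply/setD1P.
  have : u \in [set a; b] by rewrite -eE -uve set21.
  have : v \in [set a; b] by rewrite -eE -uve set22.
  by move=> /set2P[]-> /set2P[]->; rewrite ?connect0 // connect_eadj_sym.
have [par [rk [rV sT]]] := rooted_grow sF cF cV.
exists par, rk; split=> //; last by apply/negP=> /(subsetP sT); rewrite setD11.
rewrite -[LHS](setD1K (CE _ eC)); congr (_ |: _); apply/eqP.
rewrite eqEsubset sT andbT; apply/subsetP=> f fF; apply/negPn/negP=> fT.
have [/eqP/cards2P[p [q [pq fE]]] sfV] := sF _ fF.
rewrite fE subUset !sub1set in sfV; case/andP: sfV => pV qV; rewrite fE in fT.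
have [C' [sC' _ cC']] := fundamental_cycle (tree_connected rV pV qV) pq fT.
have sC'F : C' \subset E :\ e.
  by apply: subset_trans sC' _; rewrite subUset sub1set -fE fF.
have C'0 := uC0 C' (conj (subset_trans sC'F (subsetDl _ _)) cC').
have C0C := uC0 C (conj sCE cC).
by have := subsetP sC'F e; rewrite -C'0 C0C eC setD11 => /(_ isT).
Qed.

(** A cycle has at least three vertices, so one of them avoids [a] and [b]. Both its cycle edges are
    kept, which later leaves a choice of chord. *)
Lemma cycle_cherry C (a b : 'I_n) :
  (forall e, e \in C -> #|e| = 2) -> is_cycle C ->
  exists t p q, [/\ t != a, t != b, [/\ t != p, t != q & p != q],
                    [set t; p] \in C & [set t; q] \in C].
Proof.
move=> C2 [/set0Pn[e eC] degC _].
have two x f : f \in C -> x \in f -> exists p q,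
    [/\ [/\ x != p, x != q & p != q], [set x; p] \in C & [set x; q] \in C].
  move=> fC xf; have : edeg C x = 2.
    case: (degC x) => // /eqP; rewrite cards_eq0 => /eqP/setP/(_ f).
    by rewrite !inE fC xf.
  move/eqP/cards2P=> [g [h [gh defs]]].
  have other g' : g' \in [set g; h] ->
      exists y, [/\ g' = [set x; y], x != y & g' \in C].
    rewrite -defs inE => /andP[g'C xg'].
    have /eqP/cards2P[y [z [yz g'E]]] := C2 _ g'C.
    have := xg'; rewrite {1}g'E in_set2 => /orP[]/eqP xE.
      by exists z; split; rewrite // xE.
    by exists y; split; rewrite // xE 1?setUC 1?eq_sym.
  have [p [gE xp gC]] := other _ (set21 g h).
  have [q [hE xq hC]] := other _ (set22 g h).
  exists p, q; rewrite -gE -hE; split=> //; split=> //.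
  by apply: contraNneq gh => pq; rewrite gE hE pq.
have /eqP/cards2P[x [y [xy eE]]] := C2 _ eC.
have xe : x \in e by rewrite eE set21.
have [p [q [[xp xq pq] pC qC]]] := two _ _ eC xe.
have [t [tC ta tb]] : exists t, [/\ exists2 f, f \in C & t \in f, t != a & t != b].
  have [xa|xa] := eqVneq x a; last first.
    have [xb|xb] := eqVneq x b; last by exists x; split=> //; exists e.
    have [pa|pa] := eqVneq p a; last first.
      by exists p; split=> //; [exists [set x; p]; rewrite ?set22 | rewrite -xb eq_sym].
    by exists q; split; [exists [set x; q]; rewrite ?set22 | rewrite -pa eq_sym
      | rewrite -xb eq_sym].
  have [pb|pb] := eqVneq p b; last first.
    by exists p; split=> //; [exists [set x; p]; rewrite ?set22 | rewrite -xa eq_sym].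
  by exists q; split; [exists [set x; q]; rewrite ?set22 | rewrite -xa eq_sym | rewrite -pb eq_sym].
have [f fC tf] := tC; have [p' [q' [? ? ?]]] := two _ _ fC tf.
by exists t, p', q'.
Qed.

End Graphs.

(** * Rayleigh quotients of symmetric matrices *)

Section SymmetricForms.
Variables (R : realType) (n : nat).
Implicit Types (A M : 'M[R]_n) (x y : 'rV[R]_n) (r : R).

Definition bform A x y : R := (x *m A *m y^T) 0 0.
Definition sqnorm x : R := \sum_i x 0 i ^+ 2.

Lemma bformE A x y : bform A x y = \sum_j \sum_i x 0 i * A i j * y 0 j.
Proof.
rewrite /bform mxE; apply: eq_bigr => j _.
by rewrite !mxE mulr_suml.
Qed.

Lemma bform1 x : bform 1%:M x x = sqnorm x.
Proof.
by rewrite /bform mulmx1 mxE; apply: eq_bigr => i _; rewrite mxE expr2.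
Qed.

Lemma bformC A x y : A^T = A -> bform A x y = bform A y x.
Proof.
move=> sA; rewrite /bform -[x *m A *m y^T]trmxK [LHS]mxE.
by rewrite !trmx_mul trmxK sA mulmxA.
Qed.

Lemma bformDl A x y z : bform A (x + y) z = bform A x z + bform A y z.
Proof. by rewrite /bform !mulmxDl mxE. Qed.

Lemma bformZl A r x z : bform A (r *: x) z = r * bform A x z.
Proof. by rewrite /bform -!scalemxAl mxE. Qed.

Lemma bformDr A x y z : bform A z (x + y) = bform A z x + bform A z y.
Proof. by rewrite /bform linearD mulmxDr mxE. Qed.

Lemma bformZr A r x z : bform A z (r *: x) = r * bform A z x.
Proof. by rewrite /bform linearZ -scalemxAr mxE. Qed.

Lemma sqnorm_ge0 x : 0 <= sqnorm x.
Proof. by apply: sumr_ge0 => i _; apply: sqr_ge0. Qed.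

Lemma sqnorm_eq0 x : (sqnorm x == 0) = (x == 0).
Proof.
apply/eqP/eqP => [x0|->]; last by apply: big1 => i _; rewrite mxE expr0n.
apply/rowP=> i; rewrite mxE; apply/eqP; rewrite -sqrf_eq0.
have := psumr_eq0P (fun j _ => sqr_ge0 (x 0 j)) x0.
by move=> /(_ i isT) ->.
Qed.

Lemma sqnorm_gt0 x : x != 0 -> 0 < sqnorm x.
Proof. by rewrite lt_def sqnorm_ge0 sqnorm_eq0 andbT. Qed.

Lemma bform_le_sqnorm A : exists2 r, 0 < r & forall x, bform A x x <= r * sqnorm x.
Proof.
(* The summand 1 keeps the constant positive, so that it can be divided by. *)
exists (1 + \sum_j \sum_i `|A i j|) => [|x].
  by rewrite ltr_pwDl // !sumr_ge0 // => j _; rewrite sumr_ge0.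
rewrite mulrDl mul1r; apply: ler_wpDl (sqnorm_ge0 x) _.
have coord i : x 0 i ^+ 2 <= sqnorm x.
  by rewrite /sqnorm (bigD1 i) //= lerDl sumr_ge0 // => j _; apply: sqr_ge0.
rewrite bformE mulr_suml; apply: ler_sum => j _.
rewrite mulr_suml; apply: ler_sum => i _.
rewrite mulrAC mulrC; apply: le_trans (ler_norm _) _; rewrite normrM.
apply: ler_wpM2l => //; rewrite ler_norml.
have := coord i; have := coord j; have := sqr_ge0 (x 0 i - x 0 j).
have := sqr_ge0 (x 0 i + x 0 j); rewrite !expr2 => *; apply/andP; split; lra.
Qed.

Definition psd M := forall x, 0 <= bform M x x.

Lemma psd_cauchy_schwarz M x y : M^T = M -> psd M ->
  bform M x y ^+ 2 <= bform M x x * bform M y y.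
Proof.
move=> sM pM; set b := bform M x y.
have expand u v : bform M (u *: x + v *: y) (u *: x + v *: y)
    = u ^+ 2 * bform M x x + 2 * u * v * b + v ^+ 2 * bform M y y.
  by rewrite !bformDl !bformDr !bformZl !bformZr (bformC y x sM) -/b; ring.
have := pM (bform M y y *: x + (- b) *: y); rewrite expand => h.
have := pM y; rewrite le_eqVlt => /predU1P[/esym y0|yp].
  rewrite y0 mulr0; have [->|b0] := eqVneq b 0; first by rewrite expr0n.
  (* In this degenerate case the coefficient is chosen to give the form the value -1. *)
  have := pM (1 *: x + (- (bform M x x + 1) / (2 * b)) *: y).
  rewrite expand y0 mulr0 addr0 expr1n mul1r mulr1.
  have -> : 2 * (- (bform M x x + 1) / (2 * b)) * b = - (bform M x x + 1).
    by field.
  by lra.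
have : 0 <= bform M y y * (bform M x x * bform M y y - b ^+ 2) by nra.
by rewrite pmulr_rge0 // subr_ge0.
Qed.

(** Cauchy-Schwarz against [x *m M] bounds the square of [sqnorm (x *m M)] by 0. *)
Lemma psd_isotropic M x : M^T = M -> psd M -> bform M x x = 0 -> x *m M = 0.
Proof.
move=> sM pM x0; apply/eqP; rewrite -sqnorm_eq0.
have : bform M x (x *m M) ^+ 2 <= 0.
  by have := psd_cauchy_schwarz x (x *m M) sM pM; rewrite x0 mul0r.
by rewrite exprn_even_le0 //= -bform1 /bform mulmx1.
Qed.

(* The largest eigenvalue is the infimum [lam] of the upper bounds of the
   Rayleigh quotient: if [lam - A] were invertible, Cauchy-Schwarz applied to
   [x] and [x (lam - A)^-1] would bound it below by a positive multiple of the
   identity. *)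
Lemma symmetric_index_exists A : (0 < n)%N -> A^T = A ->
  exists2 lam, is_index A lam & forall x, bform A x x <= lam * sqnorm x.
Proof.
move=> n0 sA.
pose L (r : R) := forall x, bform A x x <= r * sqnorm x.
have [C0 _ LC0] := bform_le_sqnorm A.
have nzv : exists v : 'rV[R]_n, v != 0.
  exists (delta_mx 0 (Ordinal n0)); apply/eqP => /matrixP/(_ 0 (Ordinal n0)).
  by rewrite !mxE !eqxx; apply/eqP; rewrite oner_eq0.
have lbL x : x != 0 -> forall r, L r -> bform A x x / sqnorm x <= r.
  by move=> x0 r Lr; rewrite ler_pdivrMr ?sqnorm_gt0.
have [v v0] := nzv.
have L0 : classical_sets.nonempty L by exists C0.
have lL : classical_sets.has_lbound L.
  by exists (bform A v v / sqnorm v) => r /(lbL v v0).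
have Linf : forall x, bform A x x <= inf L * sqnorm x.
  move=> x; have [->|x0] := eqVneq x 0.
    have /eqP-> : sqnorm 0 == 0 by rewrite sqnorm_eq0.
    by rewrite /bform !mul0mx mxE mulr0.
  rewrite -ler_pdivrMr ?sqnorm_gt0 //; apply: lb_le_inf L0 _.
  by move=> r; apply: lbL.
exists (inf L) => //.
pose M := (inf L)%:M - A.
have ME x y : bform M x y = inf L * bform 1%:M x y - bform A x y.
  by rewrite /bform /M mulmxBr mulmxBl mul_mx_scalar mulmx1 -scalemxAl !mxE.
have sM : M^T = M by rewrite /M linearB /= tr_scalar_mx sA.
have pM : psd M by move=> x; rewrite ME bform1 subr_ge0.
split; last first.
  move=> mu /eigenvalueP[x xA x0]; rewrite -(ler_pM2r (sqnorm_gt0 x0)).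
  suff -> : mu * sqnorm x = bform A x x by [].
  by rewrite -bform1 -bformZl /bform mulmx1 -xA.
case: (boolP (eigenvalue A (inf L))) => // nev; exfalso.
have uM : M \in unitmx.
  rewrite -row_free_unit -kermx_eq0; apply: contraNT nev => /rowV0Pn[x].
  move=> /sub_kermxP; rewrite mulmxBr mul_mx_scalar => /eqP.
  by rewrite subr_eq0 => /eqP/esym xA x0; apply/eigenvalueP; exists x.
have [C C_gt0 LC] := bform_le_sqnorm (invmx M).
have low x : sqnorm x / C <= bform M x x.
  have [->|x0] := eqVneq x 0.
    by rewrite -bform1 /bform !mul0mx mxE mul0r.
  have xp := sqnorm_gt0 x0.
  have := psd_cauchy_schwarz x (x *m invmx M) sM pM.
  have sI : (invmx M)^T = invmx M by rewrite trmx_inv sM.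
  (* Cauchy-Schwarz thus bounds [sqnorm x ^+ 2] by [bform M x x] times [bform (invmx M) x x]. *)
  have -> : bform M x (x *m invmx M) = sqnorm x.
    by rewrite -bform1 /bform trmx_mul sI mulmxA mulmxK // mulmx1.
  have -> : bform M (x *m invmx M) (x *m invmx M) = bform (invmx M) x x.
    by rewrite /bform mulmxKV // trmx_mul sI mulmxA.
  move=> h; have := LC x; have := pM x => h1 h2.
  rewrite ler_pdivrMr // -(ler_pM2r xp) -expr2; apply: le_trans h _.
  by rewrite -mulrA; apply: ler_wpM2l.
(* A number below the infimum would also bound the Rayleigh quotient. *)
have : L (inf L - C^-1).
  by move=> x; have := low x; rewrite ME bform1 mulrBl [C^-1 * _]mulrC; lra.
move=> /(ge_inf lL); have : 0 < C^-1 by rewrite invr_gt0.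
by lra.
Qed.

(** The form of [lam - A] is positive semidefinite and vanishes at [x], so [x] lies in its
    kernel. *)
Lemma rayleigh_eigenvector A lam x : A^T = A ->
  (forall y, bform A y y <= lam * sqnorm y) -> lam * sqnorm x <= bform A x x ->
  x *m A = lam *: x.
Proof.
move=> sA ub lb; pose M := lam%:M - A.
have ME y : bform M y y = lam * sqnorm y - bform A y y.
  by rewrite -bform1 /bform /M mulmxBr mulmxBl mul_mx_scalar mulmx1 -scalemxAl !mxE.
have sM : M^T = M by rewrite /M linearB /= tr_scalar_mx sA.
have pM : psd M by move=> y; rewrite ME subr_ge0.
have : x *m M = 0.
  by apply: psd_isotropic => //; apply/eqP; rewrite eq_le pM ME subr_le0 lb.
by rewrite mulmxBr mul_mx_scalar => /eqP; rewrite subr_eq0 => /eqP.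
Qed.

End SymmetricForms.

(** * Edge sums and the quadratic form of a signed complete graph *)

Section EdgeSums.
Variables (R : realType) (n : nat).
Implicit Types (V : {set 'I_n}) (E : {set {set 'I_n}}) (x y : 'I_n -> R).

Definition nbsum E x (j : 'I_n) : R := \sum_(i | [set i; j] \in E) x i.

(** The sum runs over ordered pairs, so each edge counts twice: this is [2 * S(E)]. *)
Definition esum E x : R := \sum_j x j * nbsum E x j.

Definition qform E x : R :=
  (\sum_i x i) ^+ 2 - \sum_i x i ^+ 2 - 2 * esum E x.

Lemma subgraph_loopless V E i : is_subgraph V E -> ([set i; i] \in E) = false.
Proof. by move=> sE; apply/negP => /sE[]; rewrite cards2 eqxx. Qed.

Lemma row_sadj V E x j : is_subgraph V E ->
  ((\row_i x i) *m sadj R E) 0 j = \sum_i x i - x j - 2 * nbsum E x j.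
Proof.
move=> sE; rewrite mxE /nbsum [X in 2 * X]big_mkcond /= mulr_sumr.
have -> : x j = \sum_i (if i == j then x i else 0).
  by rewrite -big_mkcond big_pred1_eq.
rewrite -!sumrB; apply: eq_bigr => i _; rewrite !mxE.
have [->|ij] := eqVneq i j; first by rewrite (subgraph_loopless _ sE); lra.
by case: ifP => _; lra.
Qed.

Lemma bform_sadj V E x : is_subgraph V E ->
  bform (sadj R E) (\row_i x i) (\row_i x i) = qform E x.
Proof.
move=> sE; rewrite /bform mxE.
under eq_bigr => j _ do rewrite (row_sadj _ _ sE) !mxE.
rewrite /qform /esum expr2 mulr_sumr [in RHS]mulr_sumr -!sumrB.
by apply: eq_bigr => j _; ring.
Qed.

Lemma sqnorm_row x : sqnorm (\row_i x i) = \sum_i x i ^+ 2.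
Proof. by apply: eq_bigr => i _; rewrite mxE. Qed.

Lemma sadj_sym E : (sadj R E)^T = sadj R E.
Proof. by apply/matrixP=> i j; rewrite !mxE eq_sym setUC. Qed.

(** The eigenvector equation read at each vertex, with the diagonal term moved to the left; [x = 0]
    is allowed. *)
Definition eigen E (lam : R) x : Prop :=
  forall j, (lam + 1) * x j = \sum_i x i - 2 * nbsum E x j.

Lemma eigen_row V E lam x : is_subgraph V E ->
  (\row_i x i) *m sadj R E = lam *: (\row_i x i) <-> eigen E lam x.
Proof.
move=> sE; split=> [h j|h].
  by move/rowP/(_ j): h; rewrite (row_sadj _ _ sE) !mxE; lra.
by apply/rowP=> j; rewrite (row_sadj _ _ sE) !mxE; have := h j; lra.
Qed.

Lemma eigen_qform E lam x : eigen E lam x -> qform E x = lam * \sum_i x i ^+ 2.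
Proof.
move=> h; rewrite /qform /esum expr2 !mulr_sumr -!sumrB.
by apply: eq_bigr => j _; have := h j; nra.
Qed.

Lemma eigen_opp E lam x : eigen E lam x -> eigen E lam (fun i => - x i).
Proof.
move=> h j; rewrite /nbsum !sumrN; have := h j; rewrite /nbsum; lra.
Qed.

Lemma set2_eq (a b i j : 'I_n) : a != b ->
  ([set i; j] == [set a; b]) = (i == a) && (j == b) || (i == b) && (j == a).
Proof.
move=> ab; apply/eqP/orP => [eq_s|[]/andP[/eqP-> /eqP->] //]; last exact: setUC.
have : i \in [set a; b] by rewrite -eq_s set21.
have : j \in [set a; b] by rewrite -eq_s set22.
have : b \in [set i; j] by rewrite eq_s set22.
have : a \in [set i; j] by rewrite eq_s set21.
move=> ha hb /set2P[]ej /set2P[]ei; rewrite {}ei {}ej in ha hb *.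
- by move: hb; rewrite !inE orbb => /eqP ba; rewrite ba eqxx in ab.
- by right; rewrite !eqxx.
- by left; rewrite !eqxx.
- by move: ha; rewrite !inE orbb => /eqP ba; rewrite ba eqxx in ab.
Qed.

Section TreeSums.
Variables (V : {set 'I_n}) (c : 'I_n) (par : 'I_n -> 'I_n) (rk : 'I_n -> nat).
Variables (a b : 'I_n).
Hypotheses (rV : rooted V c par rk) (ab : a != b).
Hypothesis abT : [set a; b] \notin tree_edges V c par.
Let E := [set a; b] |: tree_edges V c par.

Lemma mem_tree_edges (i j : 'I_n) : ([set i; j] \in tree_edges V c par) =
  (j \in V :\ c) && (i == par j) || (i \in V :\ c) && (par i == j).
Proof.
apply/imsetP/orP => [[v vV /eqP]|].
  rewrite set2_eq; last by rewrite eq_sym (par_neq rV).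
  by case/orP=> /andP[/eqP-> /eqP->]; [right | left]; rewrite vV eqxx.
by case=> /andP[vV /eqP e]; [exists j; rewrite // e setUC | exists i; rewrite // e].
Qed.

(** The summands are the parent, the children and the other end of the chord; [abT] and the strict
    drop of [rk] ensure that no neighbour is counted twice. *)
Lemma nbsum_tree x j : nbsum E x j =
  (if j \in V :\ c then x (par j) else 0) + \sum_(v in V :\ c | par v == j) x v
  + (if j == a then x b else 0) + (if j == b then x a else 0).
Proof.
have -> : (if j \in V :\ c then x (par j) else 0)
   = \sum_i (if (j \in V :\ c) && (i == par j) then x i else 0).
  case: ifP => /= _; last by rewrite big1.
  by rewrite -big_mkcond big_pred1_eq.
have single d e : (if j == d then x e else 0)
   = \sum_i (if (j == d) && (i == e) then x i else 0).
  case: ifP => /= _; last by rewrite big1.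
  by rewrite -big_mkcond big_pred1_eq.
rewrite !single [X in _ + X + _ + _]big_mkcond -!big_split /nbsum big_mkcond /=.
apply: eq_bigr => i _; rewrite in_setU1 set2_eq // mem_tree_edges.
have ab_excl : (i == a) && (j == b) || (i == b) && (j == a) ->
    ((j \in V :\ c) && (i == par j) || (i \in V :\ c) && (par i == j)) = false.
  move=> h; rewrite -mem_tree_edges; apply/negbTE.
  by move: h abT; rewrite -set2_eq // => /eqP->.
have tt_excl : (j \in V :\ c) && (i == par j) -> (i \in V :\ c) && (par i == j) = false.
  case/andP=> jV /eqP ip; apply/negP => /andP[iV /eqP jp].
  have [_] := rV.2 _ jV; have [_] := rV.2 _ iV; rewrite jp -ip.
  by move=> /ltn_trans h /h; rewrite ltnn.
have lr_excl : (i == a) && (j == b) -> (i == b) && (j == a) = false.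
  by case/andP=> /eqP-> /eqP->; rewrite (negPf ab).
rewrite (andbC (j == a)) (andbC (j == b)).
case h1: ((i == a) && (j == b)) ab_excl lr_excl => /=.
  by move=> /(_ isT)/norP[/negPf-> /negPf->] /(_ isT) ->; rewrite !add0r.
case h2: ((i == b) && (j == a)) => /=.
  by move=> /(_ isT)/norP[/negPf-> /negPf->] _; rewrite !add0r addr0.
move=> _ _; case h3: ((j \in V :\ c) && (i == par j)) tt_excl => /=.
  by move=> /(_ isT) ->; rewrite !addr0.
by move=> _; rewrite add0r !addr0.
Qed.

Lemma esum_tree x :
  esum E x = 2 * (\sum_(v in V :\ c) x v * x (par v) + x a * x b).
Proof.
rewrite /esum; under eq_bigr => j _ do rewrite nbsum_tree !mulrDr.
rewrite !big_split /=.
have single d e : \sum_j x j * (if j == d then x e else 0) = x d * x e.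
  by rewrite (bigD1 d) //= eqxx big1 ?addr0 // => j /negPf->; rewrite mulr0.
rewrite !single.
have -> : \sum_j x j * (if j \in V :\ c then x (par j) else 0)
  = \sum_(v in V :\ c) x v * x (par v).
  by rewrite [RHS]big_mkcond; apply: eq_bigr => j _; case: ifP => //; rewrite mulr0.
have -> : \sum_j x j * (\sum_(v in V :\ c | par v == j) x v)
  = \sum_(v in V :\ c) x v * x (par v).
  under eq_bigr => j _ do rewrite mulr_sumr big_mkcondr.
  rewrite exchange_big; apply: eq_bigr => v _ /=.
  rewrite -big_mkcond /= (eq_bigl (pred1 (par v))) => [|i /=]; last exact: eq_sym.
  by rewrite big_pred1_eq mulrC.
ring.
Qed.

End TreeSums.

Lemma sum_mem_seq (A : {set 'I_n}) (l : seq 'I_n) (P : pred 'I_n) x :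
  uniq l -> A =i l -> \sum_(i in A | P i) x i = \sum_(i <- l | P i) x i.
Proof.
move=> Ul Al; rewrite (eq_bigl (fun i => (i \in l) && P i)) => [|i]; last by rewrite Al.
by rewrite big_mkcondr [RHS]big_mkcond [RHS]big_uniq.
Qed.

Lemma sum_ge_seq (l : seq 'I_n) x : uniq l -> (forall i, i \notin l -> 0 <= x i) ->
  \sum_(i <- l) x i <= \sum_i x i.
Proof.
move=> Ul x0; rewrite big_uniq //= [leRHS](bigID (mem l)) /= lerDl.
exact: sumr_ge0.
Qed.

Lemma exists_min (A : {set 'I_n}) x a : a \in A ->
  exists2 m, m \in A & forall v, v \in A -> x m <= x v.
Proof. by move=> aA; case: (arg_minP x aA) => m mA h; exists m. Qed.

End EdgeSums.

(** Applied to five listed vertices, this is how [n > 5] yields the sixth one. *)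
Lemma exists_notin n (l : seq 'I_n) : (size l < n)%N -> exists z, z \notin l.
Proof.
move=> ln; apply/existsP; rewrite -negb_forall; apply: contraL ln => /forallP h.
rewrite -leqNgt -[X in (X <= _)%N]card_ord.
by apply: leq_trans (card_size l); apply/subset_leq_card/subsetP => z _; apply: h.
Qed.

(** * Triangles with pendant edges at one vertex *)

Definition pendant_triangle n (V : {set 'I_n}) (c u v : 'I_n) : {set {set 'I_n}} :=
  [set u; v] |: tree_edges V c (fun=> c).

Lemma star_rooted n (V : {set 'I_n}) c :
  c \in V -> rooted V c (fun=> c) (fun v => (v != c) : nat).
Proof.
by move=> cV; split=> // v; rewrite inE => /andP[/[!inE] vc _]; rewrite eqxx vc.
Qed.

Lemma star_no_chord n (V : {set 'I_n}) c u v :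
  u \in V :\ c -> v \in V :\ c -> [set u; v] \notin tree_edges V c (fun=> c).
Proof.
rewrite !inE => /andP[uc _] /andP[vc _]; apply/imsetP=> -[w _ /setP/(_ c)].
by rewrite !inE eqxx orbT !(eq_sym c) (negPf uc) (negPf vc).
Qed.

Lemma pendant_triangle_unicyclic n (V : {set 'I_n}) c u v :
  c \in V -> u \in V :\ c -> v \in V :\ c -> u != v ->
  unicyclic V (pendant_triangle V c u v).
Proof.
move=> cV uV vV uv; apply: (unicyclic_tree (star_rooted cV)) => //.
- by case/setD1P: uV.
- by case/setD1P: vV.
- exact: star_no_chord.
Qed.

(** Tree plus chord gives [E] as many edges as [V] has vertices. The star at [c] takes all but one,
    and the last edge joins two vertices other than [c], closing the triangle. *)
Lemma star_iso_tri_pendant n k (V : {set 'I_n}) E c :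
  #|V| = k -> unicyclic V E -> c \in V ->
  (forall v, v \in V :\ c -> [set v; c] \in E) -> iso_tri_pendant k V E.
Proof.
move=> cardV uE cV starE; have [sE _ [C [[sCE cC] _]]] := uE.
have := cC => -[/set0Pn[e eC] _ _].
have [par [rk [rV EE eT]]] := cycle_edge_decomp uE sCE cC eC cV.
pose S := tree_edges V c (fun=> c).
have cardT (p : 'I_n -> 'I_n) (r : 'I_n -> nat) : rooted V c p r ->
    #|tree_edges V c p| = #|V :\ c|.
  by move=> rp; rewrite card_in_imset //; apply: tree_edge_inj rp.
have sSE : S \subset E by apply/subsetP=> f /imsetP[v vV ->]; apply: starE.
have /eqP/cards1P[f fE] : #|E :\: S| = 1%N.
  rewrite cardsD (setIidPr sSE) EE cardsU1 eT (cardT _ _ rV).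
  by rewrite (cardT _ _ (star_rooted cV)) addnK.
have /setDP[fEE fS] : f \in E :\: S by rewrite fE set11.
have [/eqP/cards2P[u [v [uv fuv]]] sfV] := sE _ fEE.
move: sfV fEE fS; rewrite {}fuv in fE *.
rewrite subUset !sub1set => /andP[uV vV] uvE uvS.
have uc : u != c.
  apply: contraNneq uvS => uc; apply/imsetP; exists v; last by rewrite uc setUC.
  by rewrite !inE vV -uc eq_sym uv.
have vc : v != c.
  apply: contraNneq uvS => vc; apply/imsetP; exists u; last by rewrite vc.
  by rewrite !inE uV uc.
have EQ : E = [set u; v] |: S.
  by rewrite -fE setUC -{1}(setID E S) (setIidPr sSE).
(* Positions 0, 1, 2 are the triangle of [tri_pendant]; the order of the rest is arbitrary. *)
pose l := [:: c, u, v & enum (V :\ c :\ u :\ v)].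
have Ul : uniq l.
  rewrite /= enum_uniq !inE !mem_enum !inE !negb_or !eqxx !(eq_sym c) uc vc uv.
  by rewrite !andbF.
have lV : l =i V.
  move=> w; rewrite !inE mem_enum !inE.
  have [->|wc] := eqVneq w c; first by rewrite cV.
  have [->|wu] := eqVneq w u; first by rewrite uV.
  by have [->|wv] := eqVneq w v; first by rewrite vV.
have sl : size l = k by rewrite -cardV -(card_uniqP Ul); apply: eq_card.
have li (i : 'I_k) : (i < size l)%N by rewrite sl.
pose g (i : 'I_k) := nth c l i.
have gi (i j : 'I_k) : (g i == g j) = (i == j) by rewrite nth_uniq.
have gd (i : 'I_k) (d : nat) : (d < 3)%N -> (g i == nth c l d) = (val i == d).
  by move=> d3; rewrite nth_uniq //; apply: leq_trans d3 _.
exists g; split.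
- by move=> i j /eqP; rewrite gi => /eqP.
- apply/setP=> w; rewrite -lV; apply/imsetP/idP => [[i _ ->]|wl].
    exact: mem_nth.
  have il : (index w l < k)%N by rewrite -sl index_mem.
  by exists (Ordinal il); rewrite // /g nth_index.
move=> i j; rewrite EQ in_setU1 set2_eq // (mem_tree_edges (star_rooted cV)).
have gV (h : 'I_k) : g h \in V by rewrite -lV; apply: mem_nth.
rewrite !inE !gV !andbT (eq_sym c) /tri_pendant -gi.
rewrite !(gd _ 0%N isT) !(gd _ 1%N isT) !(gd _ 2%N isT) gi -val_eqE /=.
by case: (val i) => [|[|[|?]]]; case: (val j) => [|[|[|?]]] //; rewrite !andbF.
Qed.

(** * Extremal graphs *)

(** Prepares the lower bounds on edge sums: the root is free, either cycle edge at [t] may serve as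
    chord, and [t] avoids two prescribed vertices. *)
Lemma unicyclic_cherry n (V : {set 'I_n}) E (a b : 'I_n) : unicyclic V E ->
  exists t p q, [/\ [/\ t \in V, p \in V & q \in V], [/\ t != a & t != b],
    [/\ t != p, t != q & p != q] &
    forall w, w \in [set p; q] -> forall c, c \in V ->
      exists par rk, [/\ rooted V c par rk, E = [set t; w] |: tree_edges V c par
        & [set t; w] \notin tree_edges V c par]].
Proof.
move=> uE; have [sE _ [C [[sCE cC] _]]] := uE.
have CE f : f \in C -> f \in E by apply: (subsetP sCE).
have C2 f : f \in C -> #|f| = 2%N by case/CE/sE.
have [t [p [q [ta tb d tpC tqC]]]] := cycle_cherry a b C2 cC.
have [_] := sE _ (CE _ tpC); have [_] := sE _ (CE _ tqC).
rewrite !subUset !sub1set => /andP[tV qV] /andP[_ pV].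
exists t, p, q; split=> // w wpq c cV; apply: (cycle_edge_decomp uE sCE cC _ cV).
by case/set2P: wpq => ->.
Qed.

Section Extremal.
Variables (R : realType) (n k : nat) (lam : R).
Hypotheses (n_gt5 : (5 < n)%N) (k_ge3 : (3 <= k)%N).
(** Extremality enters through two facts: [lam] bounds the Rayleigh quotients of all competitors,
    and equality forces the eigenvector equations. *)
Hypothesis qform_le : forall (V : {set 'I_n}) E, unicyclic V E -> #|V| = k ->
  forall y, qform E y <= lam * \sum_i y i ^+ 2.
Hypothesis qform_eigen : forall (V : {set 'I_n}) E, unicyclic V E -> #|V| = k ->
  forall y, lam * \sum_i y i ^+ 2 <= qform E y -> eigen E lam y.
Implicit Types (V : {set 'I_n}) (E : {set {set 'I_n}}) (x y : 'I_n -> R).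

(** The graph enters [qform] only through [esum], so an edge sum no larger keeps the Rayleigh
    quotient at [lam] or above: the equality case. *)
Lemma eigen_transfer V E E' x : unicyclic V E' -> #|V| = k ->
  eigen E lam x -> esum E' x <= esum E x -> eigen E' lam x.
Proof.
move=> uE' cV xE le; apply: (qform_eigen uE' cV).
by rewrite -(eigen_qform xE) /qform; lra.
Qed.

Lemma pick_two V c : c \in V -> #|V| = k ->
  exists u v, [/\ u \in V :\ c, v \in V :\ c & u != v].
Proof.
move=> cV cardV; have : (1 < #|V :\ c|)%N.
  by have := cardsD1 c V; rewrite cV cardV add1n -ltnS => <-.
by case/card_gt1P=> u [v [? ? ?]]; exists u, v.
Qed.

(** The test vector is the indicator of the complement of [c], which sees only the chord: with
    [N = n - 1 >= 5] the form is [N^2 - N - 4], more than [3 * N]. *)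
Lemma lam_gt3 V : #|V| = k -> 3 < lam.
Proof.
move=> cardV; have [c cV] : exists c, c \in V.
  by apply/card_gt0P; rewrite cardV (leq_trans _ k_ge3).
have [u [v [uV vV uv]]] := pick_two cV cardV.
have := qform_le (pendant_triangle_unicyclic cV uV vV uv) cardV (fun i => (i != c)%:R).
rewrite /qform /pendant_triangle.
rewrite (esum_tree (star_rooted cV)) ?star_no_chord //.
rewrite [X in 2 * (2 * (X + _))]big1 => [|w _]; last by rewrite eqxx mulr0.
have [/setD1P[-> _] /setD1P[-> _]] := (uV, vV).
have -> : \sum_(i < n) (i != c)%:R ^+ 2 = \sum_(i < n) (i != c)%:R :> R.
  by apply: eq_bigr => i _; case: (i != c); rewrite ?expr1n ?expr0n.
have -> : \sum_(i < n) (i != c)%:R = n.-1%:R :> R.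
  rewrite -natr_sum -[n in n.-1]card_ord (cardD1 c) /= -sum1_card [in RHS]big_mkcond /=.
  by congr (_%:R); apply: eq_bigr => i _; rewrite !inE andbT; case: eqP.
have : 5 <= n.-1%:R :> R by rewrite ler_nat -ltnS prednK // (ltn_trans _ n_gt5).
rewrite add0r !mulr1; move: (n.-1%:R : R) => N N5 h.
have [//|lam3] := ltP 3 lam.
have N0 : 0 <= N by lra.
have h1 : lam * N <= 3 * N by apply: ler_wpM2r.
have h2 : 5 * N <= N ^+ 2 by rewrite expr2; apply: ler_wpM2r.
by clear cardV; lra.
Qed.

(** The cheapest parent is always [c], and the cheapest chord avoiding [c] joins the next two
    smallest vertices [u] and [v]. So [x] also solves the equations of that pendant triangle. *)
Lemma nonneg_extremal_star V E x c : #|V| = k -> unicyclic V E ->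
  eigen E lam x -> (exists i, x i != 0) -> c \in V ->
  (forall v, v \in V :\ c -> 0 <= x v /\ x c <= x v) ->
  forall v, v \in V :\ c -> [set v; c] \in E.
Proof.
move=> cardV uE xE [i0 xi0] cV hx.
have lam3 := lam_gt3 cardV.
have [u0 [v0 [u0V v0V uv0]]] := pick_two cV cardV.
have [u uV umin] := exists_min x u0V.
have [v vV' vmin] : exists2 v, v \in V :\ c :\ u & forall w, w \in V :\ c :\ u -> x v <= x w.
  have [uu0|uu0] := eqVneq u u0.
    by apply: (@exists_min _ _ _ _ v0); rewrite in_setD1 v0V uu0 eq_sym uv0.
  by apply: (@exists_min _ _ _ _ u0); rewrite in_setD1 u0V eq_sym uu0.
have /setD1P[vu vV] := vV'; have uv : u != v by rewrite eq_sym.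
have uQ := pendant_triangle_unicyclic cV uV vV uv.
have nbQ := nbsum_tree (star_rooted cV) uv (star_no_chord uV vV) x.
have xQ : eigen (pendant_triangle V c u v) lam x.
  apply: (eigen_transfer uQ cardV xE).
  have [t [p [q [[tV pV qV] [tc _] [tp tq pq] dec]]]] := unicyclic_cherry c c uE.
  (* At most one of the two cycle neighbours of [t] is [c], so a chord avoiding [c] is available. *)
  have [w [wpq wc tw wV]] : exists w, [/\ w \in [set p; q], w != c, t != w & w \in V].
    have [pc|pc] := eqVneq p c; last by exists p; rewrite set21.
    by exists q; rewrite set22 tq qV -pc eq_sym pq.
  have [par [rk [rV -> twT]]] := dec _ wpq _ cV.
  rewrite (esum_tree rV) // (esum_tree (star_rooted cV)) ?star_no_chord //.
  rewrite ler_pM2l //; apply: lerD.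
    apply: ler_sum => z zV; apply: ler_wpM2l; first by have [] := hx _ zV.
    have [pzV _] := rV.2 _ zV; have [->//|pzc] := eqVneq (par z) c.
    by have [] := hx (par z); rewrite // !inE pzc.
  have tVc : t \in V :\ c by rewrite !inE tc.
  have wVc : w \in V :\ c by rewrite !inE wc.
  have [u0' _] := hx _ uV; have [v0' _] := hx _ vV.
  have [tu|tu] := eqVneq t u.
    rewrite tu; apply: ler_wpM2l => //; apply: vmin.
    by rewrite in_setD1 wVc -tu eq_sym tw.
  rewrite mulrC; apply: ler_pM => //; last exact: umin.
  by apply: vmin; rewrite in_setD1 tVc tu.
(* The equations at [c] for the two graphs differ only in the neighbour sums, which must therefore
   agree. *)
have nbc : nbsum E x c = \sum_(w in V :\ c) x w.
  have := xQ c; have := xE c; rewrite nbQ setD11 add0r.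
  have /setD1P[/negPf uc _] := uV; have /setD1P[/negPf vc _] := vV.
  have -> : \sum_(w in V :\ c | c == c) x w = \sum_(w in V :\ c) x w.
    by apply: eq_bigl => w; rewrite eqxx andbT.
  rewrite !(eq_sym c) uc vc !addr0.
  by move=> -> ?; lra.
have sE : is_subgraph V E by case: uE.
have zero w : w \in V :\ c -> [set w; c] \notin E -> x w = 0.
  move=> wV wE.
  have /psumr_eq0P h : \sum_(w in V :\ c) (if [set w; c] \in E then 0 else x w) = 0.
    apply: (addrI (nbsum E x c)); rewrite addr0 {2}nbc.
    have -> : nbsum E x c = \sum_(w in V :\ c) (if [set w; c] \in E then x w else 0).
      rewrite -big_mkcondr; apply: eq_bigl => w'; case E1: (_ \in E); rewrite ?andbF //.
      rewrite andbT; have [_] := sE _ E1; rewrite subUset sub1set => /andP[w'V _].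
      rewrite !inE w'V andbT; apply/esym; apply: contraTneq E1 => ->.
      by rewrite (subgraph_loopless _ sE).
    by rewrite -big_split; apply: eq_bigr => w' _; case: ifP => _ /=; rewrite ?addr0 ?add0r.
  have := h _ w wV; rewrite (negPf wE); apply.
  by move=> z zV; case: ifP => // _; have [] := hx _ zV.
(* A vertex not joined to [c] forces [x u = 0]; the equations at [u] and [v], at the leaves, at [c]
   and outside [V] then make [x] vanish. *)
move=> w wV; apply/negPn/negP=> /(zero _ wV) xw0.
have xu0 : x u = 0 by apply/eqP; rewrite eq_le -{1}xw0 umin //; have [] := hx _ uV.
have nochild z : z \in V :\ c -> \sum_(y in V :\ c | c == z) x y = 0.
  move=> zV; rewrite big_pred0 // => y.
  by rewrite eq_sym; case/setD1P: zV => /negPf->; rewrite andbF.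
have leaf z : z \in V :\ c -> z != u -> z != v -> (lam + 1) * x z = \sum_i x i - 2 * x c.
  by move=> zV /negPf zu /negPf zv; rewrite xQ nbQ zV zu zv nochild // !addr0.
have := xQ u; rewrite nbQ uV nochild // eqxx (negPf uv) xu0 mulr0 !addr0 => equ.
have := xQ v; rewrite nbQ vV nochild // eqxx (negPf vu) xu0 !addr0 => eqv.
have xv0 : x v = 0.
  have /eqP : (lam - 1) * x v = 0 by lra.
  by rewrite mulf_eq0 => /orP[]/eqP //; lra.
have sc : \sum_i x i = 2 * x c by lra.
have V0 z : z \in V :\ c -> x z = 0.
  move=> zV; have [->//|zu] := eqVneq z u; have [->//|zv] := eqVneq z v.
  have /eqP := leaf z zV zu zv; rewrite sc subrr mulf_eq0 => /orP[]/eqP //; lra.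
have xc0 : x c = 0.
  have := xE c; rewrite nbc sc big1 // => eqc.
  have /eqP : (lam - 1) * x c = 0 by lra.
  by rewrite mulf_eq0 => /orP[]/eqP //; lra.
case/eqP: xi0; have [->//|i0c] := eqVneq i0 c.
have [i0V|i0V] := boolP (i0 \in V); first by apply: V0; rewrite !inE i0c.
have := xE i0; rewrite sc xc0 /nbsum big_pred0 => [eq0|z].
  have /eqP : (lam + 1) * x i0 = 0 by lra.
  by rewrite mulf_eq0 => /orP[]/eqP //; lra.
apply: contraNF i0V => /sE[_]; rewrite subUset => /andP[_].
by rewrite sub1set.
Qed.

(** * Two negative and two positive entries on [V] *)

Section MixedSigns.
Variables (V : {set 'I_n}) (E : {set {set 'I_n}}) (x : 'I_n -> R).
Variables (m m2 M M2 : 'I_n).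
Hypotheses (cardV : #|V| = k) (uE : unicyclic V E) (xE : eigen E lam x).
Hypothesis sum_ge0 : 0 <= \sum_i x i.
Hypotheses (mV : m \in V) (m2V : m2 \in V) (MV : M \in V) (M2V : M2 \in V).
Hypotheses (m2m : m2 != m) (M2M : M2 != M).
Hypotheses (xm2 : x m2 < 0) (xM2 : 0 < x M2).
Hypothesis m_min : forall v, v \in V -> x m <= x v.
Hypothesis m2_min : forall v, v \in V -> v != m -> x m2 <= x v.
Hypothesis M_max : forall v, v \in V -> x v <= x M.
Hypothesis M2_max : forall v, v \in V -> v != M -> x v <= x M2.

Let xm : x m < 0. Proof. exact: le_lt_trans (m_min m2V) xm2. Qed.
Let xM : 0 < x M. Proof. exact: lt_le_trans xM2 (M_max M2V). Qed.

Let neg_neq_pos a b : x a < 0 -> 0 <= x b -> a != b.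
Proof. by move=> a0; apply: contraTneq => <-; rewrite -ltNge. Qed.

Let mM : m != M. Proof. exact: neg_neq_pos (ltW xM). Qed.
Let mM2 : m != M2. Proof. exact: neg_neq_pos (ltW xM2). Qed.
Let m2M : m2 != M. Proof. exact: neg_neq_pos (ltW xM). Qed.
Let m2M2 : m2 != M2. Proof. exact: neg_neq_pos (ltW xM2). Qed.

(** The cheapest parent is [m] for a nonnegative entry and [M] for a negative one. With the chord,
    [m], [M], [m2], [M2] form a 4-cycle. *)
Let dpar (v : 'I_n) : 'I_n := if 0 <= x v then m else M.
Let drk (v : 'I_n) : nat := if v == m then 0 else if 0 <= x v then 1 else 2.
Let D := [set m2; M2] |: tree_edges V m dpar.

Let rD : rooted V m dpar drk.
Proof.
split=> // v /setD1P[vm vV]; rewrite /dpar /drk (negPf vm).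
case: ifP => _; first by rewrite eqxx.
by rewrite eq_sym (negPf mM) (ltW xM).
Qed.

Let chordD : [set m2; M2] \notin tree_edges V m dpar.
Proof.
rewrite (mem_tree_edges rD) /dpar (ltW xM2) leNgt xm2 /=.
by rewrite (negPf m2m) andbF (eq_sym M) (negPf M2M) andbF.
Qed.

Let uD : unicyclic V D.
Proof. exact: (unicyclic_tree rD). Qed.

(** Away from [m] and [M], entries lie between [x m2] and [x M2], so no product is below that of
    these extremes. *)
Let chord_ge t w : t \in V -> w \in V -> t != m -> t != M -> w != m -> w != M ->
  x m2 * x M2 <= x t * x w.
Proof.
move=> tV wV tm tM wm wM.
have neg : x m2 * x M2 <= 0 by rewrite mulr_le0_ge0 // ltW.
have mixed a b : 0 <= a -> a <= x M2 -> x m2 <= b -> x m2 * x M2 <= a * b.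
  move=> a0 aM2 m2b; apply: (@le_trans _ _ (x m2 * a)).
    by apply: ler_wnM2l => //; apply: ltW.
  by rewrite mulrC; apply: ler_wpM2l.
have [t0|t0] := leP 0 (x t); first exact: mixed t0 (M2_max tV tM) (m2_min wV wm).
have [w0|w0] := leP 0 (x w).
  by rewrite [leRHS]mulrC; apply: mixed w0 (M2_max wV wM) (m2_min tV tm).
by apply: le_trans neg _; rewrite mulr_le0 // ltW.
Qed.

Let xD : eigen D lam x.
Proof.
apply: (eigen_transfer uD cardV xE).
have [t [p [q [[tV pV qV] [tm tM] [tp tq pq] dec]]]] := unicyclic_cherry m M uE.
(* Either a cycle neighbour of [t] avoids [m] and [M], or the two neighbours are [m] and [M], and
   the one with the sign of [x t] gives a nonnegative product. *)
have [w [wpq tw le_w]] : exists w, [/\ w \in [set p; q], t != w & x m2 * x M2 <= x t * x w].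
  have mixed w : w \in V -> w \notin [set m; M] -> x m2 * x M2 <= x t * x w.
    by move=> wV; rewrite !inE negb_or => /andP[wm wM]; apply: chord_ge.
  have neg : x m2 * x M2 <= 0 by rewrite mulr_le0_ge0 // ltW.
  have [pmM|pmM] := boolP (p \in [set m; M]); last by exists p; rewrite set21 mixed.
  have [qmM|qmM] := boolP (q \in [set m; M]); last by exists q; rewrite set22 mixed.
  have [t0|t0] := leP 0 (x t).
    have Mpq : M \in [set p; q].
      case/set2P: pmM => pE; last by rewrite pE set21.
      by case/set2P: qmM => qE; [rewrite pE qE eqxx in pq | rewrite qE set22].
    by exists M; rewrite Mpq tM; split=> //; apply: le_trans neg _; rewrite mulr_ge0 // ltW.
  have mpq : m \in [set p; q].
    case/set2P: pmM => pE; first by rewrite pE set21.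
    by case/set2P: qmM => qE; [rewrite qE set22 | rewrite pE qE eqxx in pq].
  by exists m; rewrite mpq tm; split=> //; apply: le_trans neg _; rewrite mulr_le0 // ltW.
have [par [rk [rV -> twT]]] := dec _ wpq _ mV.
rewrite (esum_tree rV) // (esum_tree rD) // ler_pM2l //; apply: lerD => //.
apply: ler_sum => z zV; have [pzV _] := rV.2 _ zV.
rewrite /dpar; have [z0|z0] := leP 0 (x z).
  exact: ler_wpM2l (m_min pzV).
by apply: ler_wnM2l (M_max pzV); apply: ltW.
Qed.

Let lam3 : 3 < lam. Proof. exact: lam_gt3 cardV. Qed.

(** Only [m] and [M] have children and the chord ends at [m2] and [M2], so [z] is a leaf at [m] or
    lies outside [V]. *)
Let nbD_nonneg z : 0 <= x z -> z != M -> z != M2 ->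
  nbsum D x z = if z \in V then x m else 0.
Proof.
move=> z0 zM zM2; rewrite (nbsum_tree rD) // (negPf zM2).
have zm : z != m by rewrite eq_sym (neg_neq_pos xm).
have zm2 : z != m2 by rewrite eq_sym (neg_neq_pos xm2).
rewrite (negPf zm2) !addr0 !inE zm /= /dpar z0 big_pred0 ?addr0 // => v.
by case: ifP; rewrite eq_sym ?(negPf zm) ?(negPf zM) andbF.
Qed.

Let out_ge0 i : i \notin V -> 0 <= x i.
Proof.
move=> iV; have /eqP : (lam + 1) * x i = \sum_i x i.
  have [sE _ _] := uE; rewrite xE /nbsum [X in 2 * X]big_pred0 ?mulr0 ?subr0 // => z.
  apply: contraNF iV => /sE[_]; rewrite subUset => /andP[_].
  by rewrite sub1set.
move/eqP=> eq; have : 0 <= (lam + 1) * x i by rewrite eq.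
by rewrite pmulr_rge0 //; have := lam3; lra.
Qed.

(** Flips every negative entry except the one at [m]. With the difference [d] and the sum [g] below,
    the squared total changes by the product of their sums. *)
Let x' (i : 'I_n) : R := if i == m then x m else `|x i|.
Let d (i : 'I_n) : R := x' i - x i.
Let g (i : 'I_n) : R := x i + x' i.

Let d_ge0 i : 0 <= d i.
Proof. by rewrite /d /x' subr_ge0; case: eqP => [->//|_]; apply: ler_norm. Qed.

Let d_neg i : x i < 0 -> i != m -> d i = - 2 * x i.
Proof. by move=> i0 im; rewrite /d /x' (negPf im) ltr0_norm //; ring. Qed.

Let g_ge0 i : i != m -> 0 <= g i.
Proof.
move=> im; rewrite /g /x' (negPf im).
by have [i0|i0] := leP 0 (x i); rewrite ?(ger0_norm i0) ?(ltr0_norm i0); lra.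
Qed.

Let g_nonneg i : 0 <= x i -> g i = 2 * x i.
Proof.
move=> i0; rewrite /g /x' ger0_norm //; case: eqP => [<-|_]; ring.
Qed.

Let d_nonneg i : 0 <= x i -> d i = 0.
Proof.
by move=> i0; rewrite /d /x' ger0_norm //; case: eqP => [<-|_]; rewrite subrr.
Qed.

Let dm : d m = 0. Proof. by rewrite /d /x' eqxx subrr. Qed.
Let gm : g m = 2 * x m. Proof. by rewrite /g /x' eqxx; ring. Qed.

Let sum_x' : \sum_i x' i = \sum_i x i + \sum_i d i.
Proof. by rewrite -big_split; apply: eq_bigr => i _; rewrite /d /=; ring. Qed.

Let sum_g : \sum_i g i = 2 * \sum_i x i + \sum_i d i.
Proof.
by rewrite mulr_sumr -big_split; apply: eq_bigr => i _; rewrite /d /g /=; ring.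
Qed.

Let sum_x'_sqr : \sum_i x' i ^+ 2 = \sum_i x i ^+ 2.
Proof.
apply: eq_bigr => i _; rewrite /x'; case: eqP => [->//|_].
by rewrite real_normK ?num_real.
Qed.

(** The norms agree and the squared totals factor. A flipped vertex [w] moves from parent [M] to
    [m], adding [d w * (x M + x m) / 2] to the edge sum; the last two products are the chords. *)
Let qform_gain u v : u \in V :\ m -> v \in V :\ m -> u != v ->
  qform (pendant_triangle V m u v) x' - qform D x
  = (\sum_i d i) * (\sum_i g i - 2 * x M - 2 * x m) + 4 * (x m2 * x M2) - 4 * (x' u * x' v).
Proof.
move=> uV vV uv; rewrite /qform sum_x' sum_g sum_x'_sqr.
rewrite /D (esum_tree rD) // (esum_tree (star_rooted mV)) ?star_no_chord //.
have sumd : \sum_i d i = \sum_(v in V :\ m) d v.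
  rewrite [RHS]big_mkcond; apply: eq_bigr => i _; rewrite !inE.
  case: eqP => [->//|_] /=; case: ifP => // /negbT/out_ge0; exact: d_nonneg.
have -> : \sum_(v in V :\ m) x' v * x' m
    = \sum_(v in V :\ m) x v * x (dpar v) + (x M + x m) / 2 * \sum_i d i.
  rewrite sumd mulr_sumr -big_split; apply: eq_bigr => w /setD1P[wm _] /=.
  rewrite {2}/x' eqxx /dpar; have [w0|w0] := leP 0 (x w).
    by rewrite d_nonneg // /x' (negPf wm) ger0_norm // mulr0 addr0.
  by rewrite d_neg // /x' (negPf wm) ltr0_norm //; field.
by field.
Qed.

Let dsum_gt0 : 0 < \sum_i d i.
Proof.
apply: (@lt_le_trans _ _ (\sum_(i <- [:: m2]) d i)); last exact: sum_ge_seq.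
by rewrite big_seq1 d_neg //; have := xm2; lra.
Qed.

(* The gain cannot be positive, and it cannot vanish when some further vertex
   [z] sees the same neighbours in both graphs but a larger total sum. *)
Let gain_absurd u v z : u \in V :\ m -> v \in V :\ m -> u != v ->
  0 <= x z -> z \notin [:: M; M2; u; v] ->
  4 * (x' u * x' v) <=
    (\sum_i d i) * (\sum_i g i - 2 * x M - 2 * x m) + 4 * (x m2 * x M2) -> False.
Proof.
move=> uV vV uv z0; rewrite !inE !negb_or => /and4P[zM zM2 zu zv] le.
have gain := qform_gain uV vV uv.
have uQ := pendant_triangle_unicyclic mV uV vV uv.
(* The gain is nonnegative by [le], so [x'] attains the bound [lam]. *)
have xQ : eigen (pendant_triangle V m u v) lam x'.
  by apply: (qform_eigen uQ cardV); rewrite sum_x'_sqr -(eigen_qform xD); lra.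
have zm : z != m by rewrite eq_sym (neg_neq_pos xm).
have := xQ z; have := xD z; rewrite nbD_nonneg // sum_x'.
rewrite (nbsum_tree (star_rooted mV)) ?star_no_chord // (negPf zu) (negPf zv).
rewrite [X in _ + X + _ + _]big_pred0 => [|w]; last first.
  by rewrite eq_sym (negPf zm) andbF.
rewrite !inE zm /= {1}/x' (negPf zm) ger0_norm // {1}/x' eqxx !addr0 => -> h.
have := dsum_gt0; move: h; move: (if _ then _ else _) (\sum_i x i) (\sum_i d i).
move=> r s e h; have -> : e = 0 by lra.
by rewrite ltxx.
Qed.

Let gain_le u v : u \in V :\ m -> v \in V :\ m -> u != v ->
  (\sum_i d i) * (\sum_i g i - 2 * x M - 2 * x m) + 4 * (x m2 * x M2)
  <= 4 * (x' u * x' v).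
Proof.
move=> uV vV uv; have := qform_gain uV vV uv.
have := qform_le (pendant_triangle_unicyclic mV uV vV uv) cardV x'.
by rewrite sum_x'_sqr -(eigen_qform xD); lra.
Qed.

Let inVm v : v \in V -> v != m -> v \in V :\ m.
Proof. by move=> vV vm; rewrite !inE vm. Qed.

Let gain_bound (p q e G : R) :
  0 <= p -> 0 <= q -> 2 * q <= e -> 2 * p <= G -> 4 * (q * p) <= e * G.
Proof.
move=> p0 q0 qe pG; have : (2 * q) * (2 * p) <= e * G by apply: ler_pM => //; lra.
by rewrite (_ : 2 * q * (2 * p) = 4 * (q * p)) //; ring.
Qed.

(** Compare with the triangle [m], [t], [M2]: flipping [m2] and [t] makes the first factor of the
    gain at least [-2 * (x m2 + x t)], and [M2] makes the second at least [2 * x M2], just enough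
    for a nonnegative gain. *)
Let no_third_negative t : t \in V -> t != m -> t != m2 -> x t < 0 -> False.
Proof.
move=> tV tm tm2 t0.
have tM2 : t != M2 by apply: neg_neq_pos (ltW xM2).
have tM : t != M by apply: neg_neq_pos (ltW xM).
have uV := inVm tV tm; have M2m : M2 != m by rewrite eq_sym.
have vV := inVm M2V M2m.
have G : 2 * x M2 <= \sum_i g i - 2 * x M - 2 * x m.
  have : \sum_(i <- [:: m; M; M2]) g i <= \sum_i g i.
    apply: sum_ge_seq => [|i]; first by rewrite /= !inE negb_or mM mM2 eq_sym M2M.
    by rewrite inE negb_or => /andP[im _]; apply: g_ge0.
  by rewrite !big_cons big_nil gm (g_nonneg (ltW xM)) (g_nonneg (ltW xM2)); lra.
have x'u : x' t = - x t by rewrite /x' (negPf tm) ltr0_norm.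
have x'v : x' M2 = x M2 by rewrite /x' (negPf M2m) gtr0_norm.
(* The sixth vertex breaks the tie: a nonnegative entry excludes equality, a negative one enlarges
   the first factor. *)
have [z] := @exists_notin n [:: m; m2; t; M; M2] n_gt5.
rewrite !inE !negb_or => /and5P[zm zm2 zt zM zM2].
have [z0|z0] := leP 0 (x z).
  apply: (gain_absurd uV vV tM2 z0); first by rewrite !inE !negb_or zM zM2 zt.
  have : \sum_(i <- [:: m2; t]) d i <= \sum_i d i.
    by apply: sum_ge_seq => //=; rewrite inE eq_sym tm2.
  rewrite !big_cons big_nil !d_neg // x'u x'v => h.
  have q0 : 0 <= - x m2 - x t by have := xm2; lra.
  have := gain_bound (ltW xM2) q0 _ G; move: h.
  by move: (\sum_i d i) (\sum_i g i) => e f h /(_ e); lra.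
have := gain_le uV vV tM2.
have : \sum_(i <- [:: m2; t; z]) d i <= \sum_i d i.
  by apply: sum_ge_seq => //=; rewrite !inE negb_or !(eq_sym _ z) zm2 zt eq_sym tm2.
rewrite !big_cons big_nil !d_neg // x'u x'v => h; apply/negP; rewrite -ltNge.
have q0 : 0 <= - x m2 - x t - x z by have := xm2; lra.
have zM2_gt0 : 0 < - x z * x M2 by rewrite mulr_gt0 // oppr_gt0.
have := gain_bound (ltW xM2) q0 _ G; move: h.
by move: (\sum_i d i) (\sum_i g i) => e f h /(_ e); lra.
Qed.

(** On [V] only [m] and [m2] are negative. If [V] has a fifth vertex [t], the triangle [m], [m2],
    [t] does at least as well as [D], and a sixth vertex excludes equality; otherwise [D] is a bare
    4-cycle. *)
Lemma mixed_signs_absurd : False.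
Proof.
have nonneg v : v \in V -> v != m -> v != m2 -> 0 <= x v.
  by move=> vV vm vm2; rewrite leNgt; apply/negP=> /(no_third_negative vV vm vm2).
have M2m : M2 != m by rewrite eq_sym.
have Mm : M != m by rewrite eq_sym.
case: (boolP [exists t, (t \in V) && (t \notin [:: m; m2; M; M2])]).
  move=> /existsP[t /andP[tV]]; rewrite !inE !negb_or => /and4P[tm tm2 tM tM2].
  have t0 := nonneg _ tV tm tm2.
  have uV := inVm m2V m2m; have vV := inVm tV tm.
  have [z] := @exists_notin n [:: m; m2; t; M; M2] n_gt5.
  rewrite !inE !negb_or => /and5P[zm zm2 zt zM zM2].
  have z0 : 0 <= x z.
    by have [zV|/out_ge0//] := boolP (z \in V); apply: nonneg.
  apply: (gain_absurd uV vV _ z0); rewrite 1?eq_sym ?inE ?negb_or ?zM ?zM2 ?zm2 //.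
  have x'u : x' m2 = - x m2 by rewrite /x' (negPf m2m) ltr0_norm.
  have x'v : x' t = x t by rewrite /x' (negPf tm) ger0_norm.
  have G : 2 * x M2 + 2 * x t <= \sum_i g i - 2 * x M - 2 * x m.
    have : \sum_(i <- [:: m; M; M2; t]) g i <= \sum_i g i.
      apply: sum_ge_seq => [|i].
        by rewrite /= !inE !negb_or mM mM2 !(eq_sym _ t) tm tM tM2 eq_sym M2M.
      by rewrite inE negb_or => /andP[im _]; apply: g_ge0.
    rewrite !big_cons big_nil gm (g_nonneg (ltW xM)) (g_nonneg (ltW xM2)).
    by rewrite (g_nonneg t0); lra.
  have : \sum_(i <- [:: m2]) d i <= \sum_i d i by apply: sum_ge_seq.
  rewrite big_seq1 d_neg // x'u x'v => h.
  have q0 : 0 <= - x m2 by rewrite oppr_ge0 ltW.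
  have p0 : 0 <= x M2 + x t by rewrite addr_ge0 // ltW.
  move: h G; move: (\sum_i d i) (\sum_i g i) => e f h G.
  have qe : 2 * - x m2 <= e by lra.
  have pG : 2 * (x M2 + x t) <= f - 2 * x M - 2 * x m by lra.
  by have := gain_bound p0 q0 qe pG; lra.
move=> nt.
have Vm : V :\ m =i [:: m2; M; M2].
  move=> v; rewrite in_setD1; apply/andP/idP => [[vm vV]|]; last first.
    by rewrite !inE => /or3P[]/eqP->.
  apply: contraNT nt => v3.
  by apply/existsP; exists v; rewrite vV in_cons negb_or vm.
have U3 : uniq [:: m2; M; M2] by rewrite /= !inE negb_or m2M m2M2 eq_sym M2M.
have nb z : nbsum D x z = _ := nbsum_tree rD m2M2 chordD x z.
have child z : \sum_(v in V :\ m | dpar v == z) x v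
    = (if M == z then x m2 else 0) + (if m == z then x M + x M2 else 0).
  rewrite (sum_mem_seq _ _ U3 Vm) !big_cons big_nil /dpar (ltW xM) (ltW xM2).
  rewrite leNgt xm2 /=; do 2!case: eqP => _; ring.
have em : (lam + 1) * x m = \sum_i x i - 2 * (x M + x M2).
  rewrite xD nb child setD11 eqxx (eq_sym M) (negPf mM) (eq_sym m) (negPf m2m).
  by rewrite (negPf mM2) !add0r !addr0.
have em2 : (lam + 1) * x m2 = \sum_i x i - 2 * (x M + x M2).
  rewrite xD nb child inVm // eqxx (eq_sym M) (negPf m2M) (eq_sym m) (negPf m2m).
  by rewrite (negPf m2M2) /dpar leNgt xm2 !addr0.
have eM : (lam + 1) * x M = \sum_i x i - 2 * (x m + x m2).
  rewrite xD nb child inVm // eqxx (negPf mM) (eq_sym M) (negPf m2M).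
  by rewrite (eq_sym M) (negPf M2M) /dpar (ltW xM) !addr0.
have eM2 : (lam + 1) * x M2 = \sum_i x i - 2 * (x m + x m2).
  rewrite xD nb child inVm // eqxx (negPf mM2) (eq_sym M) (negPf M2M).
  by rewrite (eq_sym M2) (negPf m2M2) /dpar (ltW xM2) !addr0.
(* Adding the equations at [M] and [M2] and subtracting those at [m] and [m2] shows that [lam - 3]
   times this quantity is 0. *)
have pos : 0 < x M + x M2 - x m - x m2 by have := (xm, xm2, xM, xM2) => -[[[]]]; lra.
have : 0 < (lam - 3) * (x M + x M2 - x m - x m2) by rewrite mulr_gt0 // subr_gt0.
by apply/negP; rewrite -leNgt; lra.
Qed.

End MixedSigns.

(** The centre is [m] if all other entries on [V] are nonnegative, and [M], by passing to [- x], if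
    all others are nonpositive; otherwise both signs occur twice. *)
Lemma extremal_star V E x : #|V| = k -> unicyclic V E -> eigen E lam x ->
  (exists i, x i != 0) ->
  exists2 c, c \in V & forall v, v \in V :\ c -> [set v; c] \in E.
Proof.
move=> cardV uE; wlog s0 : x / 0 <= \sum_i x i => [hw|] xE [i xi].
  have [s0|s0] := leP 0 (\sum_i x i); first by apply: (hw x) => //; exists i.
  apply: (hw (fun i => - x i)); last by exists i; rewrite oppr_eq0.
    by rewrite sumrN oppr_ge0 ltW.
  exact: eigen_opp.
have [c0 c0V] : exists c, c \in V.
  by apply/card_gt0P; rewrite cardV (leq_trans _ k_ge3).
have star := nonneg_extremal_star cardV uE.
have [m mV m_min] := exists_min x c0V.
have [/forall_inP pos|] := boolP [forall v in V :\ m, 0 <= x v].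
  exists m => //; apply: (star x) => // [|v vV]; first by exists i.
  by split; [apply: pos | apply: m_min; case/setD1P: vV].
rewrite negb_forall_in => /exists_inP[v vV]; rewrite -ltNge => xv.
have [m2 /setD1P[m2m m2V] m2_min] := exists_min x vV.
have [M MV M_max] := exists_min (fun i => - x i) c0V.
have [/forall_inP neg|] := boolP [forall v in V :\ M, x v <= 0].
  exists M => //; apply: (star (fun i => - x i)) => // [||w wV].
  - exact: eigen_opp.
  - by exists i; rewrite oppr_eq0.
  by rewrite oppr_ge0; split; [apply: neg | apply: M_max; case/setD1P: wV].
rewrite negb_forall_in => /exists_inP[w wV]; rewrite -ltNge => xw.
have [M2 /setD1P[M2M M2V] M2_max] := exists_min (fun i => - x i) wV.
exfalso; apply: (mixed_signs_absurd cardV uE xE s0 mV m2V MV M2V m2m M2M) => //.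
- exact: le_lt_trans (m2_min _ vV) xv.
- by apply: lt_le_trans xw _; rewrite -lerN2 M2_max.
- by move=> z zV zm; apply: m2_min; rewrite !inE zm.
- by move=> z zV; rewrite -lerN2 M_max.
- by move=> z zV zM; rewrite -lerN2 M2_max // !inE zM.
Qed.

End Extremal.

Unset Implicit Arguments.

Theorem theorem3p6 (R : realType) (n k : nat)
  (V : {set 'I_n}) (E : {set {set 'I_n}}) (lam : R) :
  (5 < n)%N -> (3 <= k <= n)%N ->
  unicyclic V E -> #|V| = k -> is_index (sadj R E) lam ->
  (forall (V' : {set 'I_n}) (E' : {set {set 'I_n}}) (lam' : R),
      unicyclic V' E' -> #|V'| = k -> is_index (sadj R E') lam' -> lam' <= lam) ->
  iso_tri_pendant k V E.
Proof.
move=> n_gt5 /andP[k_ge3 _] uE cardV [ev _] lam_max.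
(* Each competitor's form is bounded by its own index, which is at most [lam] by maximality. *)
have bform_le (V' : {set 'I_n}) E' y : unicyclic V' E' -> #|V'| = k ->
    bform (sadj R E') y y <= lam * sqnorm y.
  move=> uE' cardV'.
  have [|mu mu_index mu_ub] := symmetric_index_exists _ (sadj_sym R E').
    exact: leq_trans n_gt5.
  apply: le_trans (mu_ub y) _; apply: ler_wpM2r; first exact: sqnorm_ge0.
  exact: lam_max uE' cardV' mu_index.
have qform_le (V' : {set 'I_n}) E' : unicyclic V' E' -> #|V'| = k ->
    forall y, qform E' y <= lam * \sum_i y i ^+ 2.
  move=> uE' cardV' y; have [sE' _ _] := uE'.
  by rewrite -(bform_sadj _ sE') -sqnorm_row; apply: bform_le uE' cardV'.
have qform_eigen (V' : {set 'I_n}) E' : unicyclic V' E' -> #|V'| = k ->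
    forall y, lam * \sum_i y i ^+ 2 <= qform E' y -> eigen E' lam y.
  move=> uE' cardV' y; have [sE' _ _] := uE'.
  rewrite -(bform_sadj _ sE') -sqnorm_row => lb; apply/(eigen_row _ _ sE').
  apply: rayleigh_eigenvector lb; first exact: sadj_sym.
  by move=> z; apply: bform_le uE' cardV'.
have [x xA x0] := eigenvalueP ev; have [sE _ _] := uE.
have rowx : \row_i x 0 i = x by apply/rowP=> i; rewrite mxE.
have xE : eigen E lam (x 0) by apply/(eigen_row _ _ sE); rewrite rowx.
have [c cV star] : exists2 c, c \in V & forall v, v \in V :\ c -> [set v; c] \in E.
  apply: (extremal_star n_gt5 k_ge3 qform_le qform_eigen cardV uE xE).
  apply/existsP; apply: contraNT x0; rewrite negb_exists => /forallP h.
  by apply/eqP/rowP=> i; rewrite mxE; apply/eqP; have := h i; rewrite negbK.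
exact: star_iso_tri_pendant cardV uE cV star.
Qed.
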